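(* Let $B$ be an algebra, $P_0$ a projective $B$-module, $A=B[P_0]$, and let $T$ be a $\tau$-tilting $B$-module. Put $eT=\mathcal{E}T\oplus S$. Then $\mathrm{End}_A(eT)$ is the one-point extension of $\mathrm{End}_B(T)$ by the module $\mathrm{Hom}_B(T,\nu_BP_0)$.
   Context: All algebras are basic connected finite dimensional algebras over an algebraically closed field $k$; $\mathrm{mod}\,C$ is the category of finitely generated left $C$-modules. The one-point extension of an algebra $C$ by a $C$-module $X$ is the matrix algebra $C[X]=\begin{pmatrix} C & X\\ 0 & k\end{pmatrix}$. With $A=B[P_0]$, there is a unique indecomposable projective $A$-module $\widetilde P$ which is not a projective $B$-module, and $S$ is its simple top. Let $U=e_BA$ with $e_B$ the identity of $B$, a $B$-$A$-bimodule; $\mathcal{E}=\mathrm{Hom}_B(U,-):\mathrm{mod}\,B\to\mathrm{mod}\,A$. $\nu_B=DB\otimes_B-$ is the Nakayama functor, with $D=\mathrm{Hom}_k(-,k)$. A $B$-module $T$ is $\tau$-tilting if $\mathrm{Hom}_B(T,\tau_BT)=0$ and $|T|=|B|$, where $|\cdot|$ is the number of pairwise non-isomorphic indecomposable direct summands. Endomorphism algebras are written so that $\mathrm{End}_A(\mathcal{E}T\oplus S)\cong\begin{pmatrix}\mathrm{End}_A(\mathcal{E}T)&\mathrm{Hom}_A(\mathcal{E}T,S)\\ \mathrm{Hom}_A(S,\mathcal{E}T)&\mathrm{End}_A S\end{pmatrix}$, i.e. composition of endomorphisms is read from left to right, so that $\mathrm{Hom}_B(T,\nu_BP_0)$ is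 a left $\mathrm{End}_B(T)$-module by precomposition. *)

(* Defs.v *)
From HB Require Import structures.
From mathcomp Require Import all_boot all_order all_algebra all_field.
From mathcomp Require Import boolp.

Set Implicit Arguments.
Unset Strict Implicit.
Unset Printing Implicit Defensive.

Import GRing.Theory.
Local Open Scope ring_scope.
Local Open Scope quotient_scope.

(* Left R-modules are [lmodType R]; right R-modules are [lmodType R^c], so that
   x r is written (r : R^c) *: x. *)

(* A k-algebra as a ring with a ring morphism from k to its centre.  MathComp's
   [algType k] cannot be used throughout: it excludes the zero ring, but End(M)
   is zero for M = 0, and it is not inherited by the converse ring R^c. *)
HB.mixin Record isCentralAlg (k : fieldType) R of GRing.PzRing R := {
  alg_unit : k -> R;
  alg_unit_is_zmod_morphism : zmod_morphism alg_unit;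
  alg_unit_is_monoid_morphism : monoid_morphism alg_unit;
  alg_unitC : forall (c : k) (x : R), alg_unit c * x = x * alg_unit c
}.

#[short(type="centralAlgType")]
HB.structure Definition CentralAlg (k : fieldType) :=
  { R of GRing.PzRing R & isCentralAlg k R }.

Arguments alg_unit {k} R c : rename.

HB.instance Definition _ (k : fieldType) (R : centralAlgType k) :=
  GRing.isZmodMorphism.Build k R (alg_unit R) alg_unit_is_zmod_morphism.
HB.instance Definition _ (k : fieldType) (R : centralAlgType k) :=
  GRing.isMonoidMorphism.Build k R (alg_unit R) alg_unit_is_monoid_morphism.

Section FalgCentral.
Variables (k : fieldType) (B : falgType k).

Fact falg_unitC (c : k) (x : B) : in_alg B c * x = x * in_alg B c.
Proof. by rewrite /= mulr_algl mulr_algr. Qed.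

HB.instance Definition _ := isCentralAlg.Build k (Falgebra.sort B)
  (raddfB (in_alg B)) (conj (rmorph1 (in_alg B)) (rmorphM (in_alg B)))
  falg_unitC.
End FalgCentral.

Section ConverseCentral.
Variables (k : fieldType) (R : centralAlgType k).

Definition conv_unit (c : k) : R^c := alg_unit R c.

Fact conv_unit_is_zmod_morphism : zmod_morphism conv_unit.
Proof. exact: alg_unit_is_zmod_morphism. Qed.
Fact conv_unit_is_monoid_morphism : monoid_morphism conv_unit.
Proof.
split=> [|a b]; first exact: (rmorph1 (alg_unit R)).
by rewrite /conv_unit mulrC (rmorphM (alg_unit R)).
Qed.
Fact conv_unitC c (x : R^c) : conv_unit c * x = x * conv_unit c.
Proof. by symmetry; exact: (@alg_unitC k R c x). Qed.

HB.instance Definition _ := isCentralAlg.Build k R^c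
  conv_unit_is_zmod_morphism conv_unit_is_monoid_morphism conv_unitC.
End ConverseCentral.

Definition alg_iso (k : fieldType) (R S : centralAlgType k) : Prop :=
  exists f : {rmorphism R -> S},
    bijective f /\ forall c : k, f (alg_unit R c) = alg_unit S c.

(* [algType]s are nonzero, so this rules out B = B1 x B2 with both factors
   nonzero; B itself is nonzero, being a [falgType]. *)
Definition connected_alg (k : fieldType) (B : falgType k) : Prop :=
  forall (B1 B2 : algType k) (f : {lrmorphism B -> (B1 * B2)%type}),
    ~ bijective f.

Definition restr (R S : pzRingType) (f : {rmorphism R -> S})
  (M : lmodType S) : Type := M.

Section Restriction.
Variables (R S : pzRingType) (f : {rmorphism R -> S}) (M : lmodType S).
Local Notation restr := (restr f M).

HB.instance Definition _ := GRing.Zmodule.on restr.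

Definition restr_scale (r : R) (x : restr) : restr := f r *: (x : M).

Fact restr_scaleA a b v : restr_scale a (restr_scale b v) = restr_scale (a * b) v.
Proof. by rewrite /restr_scale scalerA rmorphM. Qed.
Fact restr_scale1 : left_id 1 restr_scale.
Proof. by move=> v; rewrite /restr_scale rmorph1 scale1r. Qed.
Fact restr_scaleDr : right_distributive restr_scale +%R.
Proof. by move=> a u v; exact: scalerDr. Qed.
Fact restr_scaleDl v : {morph restr_scale^~ v : a b / a + b}.
Proof. by move=> a b; rewrite /restr_scale rmorphD; exact: scalerDl. Qed.

HB.instance Definition _ := GRing.Zmodule_isLmodule.Build R restr
  restr_scaleA restr_scale1 restr_scaleDr restr_scaleDl.
End Restriction.

(* The k-space underlying a module over a k-algebra. *)
Notation kspace R M := (restr (alg_unit R) M).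

Section Hom.
Variables (R : pzRingType) (M N : lmodType R).

Definition modhom : Type := {linear M -> N}.

HB.instance Definition _ := gen_eqMixin modhom.
HB.instance Definition _ := gen_choiceMixin modhom.

Definition hom_fun (f : modhom) : {linear M -> N} := f.
Coercion hom_fun : modhom >-> GRing.Linear.type.

Lemma homP (f g : modhom) : f =1 g -> f = g.
Proof.
case: f g => [f cf] [g cg] /= efg.
have {}efg : f = g by exact: funext efg.
case: _ / efg cg => cg; congr GRing.Linear.Pack.
case: cf cg => a b [c d]; congr GRing.Linear.Class.
  case: a c => a [c]; congr Algebra.isNmodMorphism.Axioms_; exact: Prop_irrelevance.
case: b d => b [d]; congr GRing.isScalable.Axioms_; exact: Prop_irrelevance.
Qed.

Definition hom_zero : modhom := \0 : {linear M -> N}.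
Definition hom_add (f g : modhom) : modhom := (f \+ g) : {linear M -> N}.
Definition hom_opp (f : modhom) : modhom := (\- f) : {linear M -> N}.

Fact hom_addA : associative hom_add.
Proof. by move=> f g h; apply: homP => x; exact: addrA. Qed.
Fact hom_addC : commutative hom_add.
Proof. by move=> f g; apply: homP => x; exact: addrC. Qed.
Fact hom_add0 : left_id hom_zero hom_add.
Proof. by move=> f; apply: homP => x; exact: add0r. Qed.
Fact hom_addN : left_inverse hom_zero hom_opp hom_add.
Proof. by move=> f; apply: homP => x; exact: addNr. Qed.

HB.instance Definition _ :=
  GRing.isZmodule.Build modhom hom_addA hom_addC hom_add0 hom_addN.
End Hom.

Definition hom_comp (R : pzRingType) (L M N : lmodType R)
  (g : modhom M N) (f : modhom L M) : modhom L N := (g \o f) : {linear L -> N}.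

(* End_R(M), with composition read from left to right: (f * g) x = g (f x). *)
Section Endo.
Variables (R : pzRingType) (M : lmodType R).

Definition endo : Type := modhom M M.

HB.instance Definition _ := GRing.Zmodule.on endo.

Definition endo_one : endo := idfun : {linear M -> M}.
Definition endo_mul (f g : endo) : endo := hom_comp g f.

Fact endo_mulA : associative endo_mul.
Proof. by move=> f g h; apply: homP. Qed.
Fact endo_mul1 : left_id endo_one endo_mul.
Proof. by move=> f; apply: homP. Qed.
Fact endo_mulr1 : right_id endo_one endo_mul.
Proof. by move=> f; apply: homP. Qed.
Fact endo_mulDl : left_distributive endo_mul +%R.
Proof. by move=> f g h; apply: homP => x; exact: (linearD (h : modhom M M)). Qed.
Fact endo_mulDr : right_distributive endo_mul +%R.
Proof. by move=> f g h; apply: homP. Qed.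

HB.instance Definition _ := GRing.Zmodule_isPzRing.Build endo
  endo_mulA endo_mul1 endo_mulr1 endo_mulDl endo_mulDr.
End Endo.

Section EndoCentral.
Variables (k : fieldType) (R : centralAlgType k) (M : lmodType R).

Definition homothety (c : k) (x : M) : M := alg_unit R c *: x.

Fact homothety_is_linear c : linear (homothety c).
Proof.
by move=> r x y; rewrite /homothety scalerDr !scalerA alg_unitC.
Qed.

HB.instance Definition _ c := GRing.isLinear.Build R M M *:%R (homothety c)
  (homothety_is_linear c).

Definition endo_unit (c : k) : endo M := homothety c : {linear M -> M}.

Fact endo_unit_is_zmod_morphism : zmod_morphism endo_unit.
Proof.
by move=> a b; apply: homP => x /=; rewrite /homothety raddfB scalerBl.
Qed.
Fact endo_unit_is_monoid_morphism : monoid_morphism endo_unit.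
Proof.
split=> [|a b]; apply: homP => x /=; rewrite /homothety.
  by rewrite rmorph1 scale1r.
by rewrite scalerA -alg_unitC rmorphM.
Qed.
Fact endo_unitC c (f : endo M) : endo_unit c * f = f * endo_unit c.
Proof. by apply: homP => x /=; exact: (linearZ_LR (f : modhom M M)). Qed.

HB.instance Definition _ := isCentralAlg.Build k (endo M)
  endo_unit_is_zmod_morphism endo_unit_is_monoid_morphism endo_unitC.
End EndoCentral.

(* Hom_R(M, N) as a left End_R(M)-module by precomposition. *)
Section HomEndo.
Variables (R : pzRingType) (M N : lmodType R).

Definition homE : Type := modhom M N.

HB.instance Definition _ := GRing.Zmodule.on homE.

Definition homE_scale (e : endo M) (g : homE) : homE := hom_comp g e.

Fact homE_scaleA a b v : homE_scale a (homE_scale b v) = homE_scale (a * b) v.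
Proof. by apply: homP. Qed.
Fact homE_scale1 : left_id 1 homE_scale.
Proof. by move=> v; apply: homP. Qed.
Fact homE_scaleDr : right_distributive homE_scale +%R.
Proof. by move=> a u v; apply: homP. Qed.
Fact homE_scaleDl v : {morph homE_scale^~ v : a b / a + b}.
Proof. by move=> a b; apply: homP => x; exact: (linearD (v : modhom M N)). Qed.

HB.instance Definition _ := GRing.Zmodule_isLmodule.Build (endo M) homE
  homE_scaleA homE_scale1 homE_scaleDr homE_scaleDl.
End HomEndo.

(* Hom_R(M, R) as a right R-module: (f r) x = f x * r. *)
Section HomRegular.
Variables (R : pzRingType) (M : lmodType R).

Definition homreg : Type := modhom M R^o.

HB.instance Definition _ := GRing.Zmodule.on homreg.

Definition homreg_scale_fun (r : R^c) (f : homreg) (x : M) : R^o :=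
  ((f : modhom M R^o) x : R) * (r : R).

Fact homreg_scale_is_linear r f : linear (homreg_scale_fun r f).
Proof.
move=> a x y; rewrite /homreg_scale_fun linearP mulrDl.
by rewrite [X in X + _](_ : _ = a * ((f : modhom M R^o) x * (r : R))) // mulrA.
Qed.

HB.instance Definition _ r f := GRing.isLinear.Build R M R^o *:%R
  (homreg_scale_fun r f) (homreg_scale_is_linear r f).

Definition homreg_scale (r : R^c) (f : homreg) : homreg :=
  homreg_scale_fun r f : {linear M -> R^o}.

Fact homreg_scaleA a b v : homreg_scale a (homreg_scale b v) = homreg_scale (a * b) v.
Proof. by apply: homP => x; symmetry; exact: mulrA. Qed.
Fact homreg_scale1 : left_id 1 homreg_scale.
Proof. by move=> v; apply: homP => x; exact: mulr1. Qed.
Fact homreg_scaleDr : right_distributive homreg_scale +%R.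
Proof. by move=> a u v; apply: homP => x; exact: mulrDl. Qed.
Fact homreg_scaleDl v : {morph homreg_scale^~ v : a b / a + b}.
Proof. by move=> a b; apply: homP => x; exact: mulrDr. Qed.

HB.instance Definition _ := GRing.Zmodule_isLmodule.Build R^c homreg
  homreg_scaleA homreg_scale1 homreg_scaleDr homreg_scaleDl.
End HomRegular.

(* D X = Hom_k(X, k) as a left R-module, for a right R-module X:
   (r xi) x = xi (x r). *)
Section Dual.
Variables (k : fieldType) (R : centralAlgType k) (X : lmodType R^c).

Definition dual : Type := modhom (kspace R^c X) k^o.

HB.instance Definition _ := GRing.Zmodule.on dual.

Definition dual_scale_fun (r : R) (xi : dual) (x : kspace R^c X) : k^o :=
  (xi : modhom _ _) ((r : R^c) *: (x : X)).

Fact dual_scale_is_linear r xi : linear (dual_scale_fun r xi).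
Proof.
move=> a x y; rewrite /dual_scale_fun -linearP; congr (hom_fun _ _).
rewrite scalerDr; congr (_ + _).
rewrite [LHS](scalerA (r : R^c) (alg_unit R^c a) (x : X)) -alg_unitC.
by rewrite -[LHS](scalerA (alg_unit R^c a) (r : R^c) (x : X)).
Qed.

HB.instance Definition _ r xi := GRing.isLinear.Build k (kspace R^c X) k^o *:%R
  (dual_scale_fun r xi) (dual_scale_is_linear r xi).

Definition dual_scale (r : R) (xi : dual) : dual :=
  dual_scale_fun r xi : {linear kspace R^c X -> k^o}.

Fact dual_scaleA a b v : dual_scale a (dual_scale b v) = dual_scale (a * b) v.
Proof.
apply: homP => x; rewrite /= /dual_scale_fun /= /dual_scale_fun.
by rewrite scalerA.
Qed.
Fact dual_scale1 : left_id 1 dual_scale.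
Proof. by move=> v; apply: homP => x /=; rewrite /dual_scale_fun scale1r. Qed.
Fact dual_scaleDr : right_distributive dual_scale +%R.
Proof. by move=> a u v; apply: homP. Qed.
Fact dual_scaleDl v : {morph dual_scale^~ v : a b / a + b}.
Proof.
move=> a b; apply: homP => x; rewrite /= /dual_scale_fun.
by rewrite [X in hom_fun _ X](scalerDl (x : X) (a : R^c) b) (linearD (v : modhom _ _)).
Qed.

HB.instance Definition _ := GRing.Zmodule_isLmodule.Build R dual
  dual_scaleA dual_scale1 dual_scaleDr dual_scaleDl.
End Dual.

(* DR, with its right R-module structure: (xi r) x = xi (r x). *)
Section DualRegular.
Variables (k : fieldType) (R : centralAlgType k).

Definition dualreg : Type := dual (R^c)^o.

HB.instance Definition _ := GRing.Zmodule.on dualreg.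

Definition dualreg_scale_fun (r : R^c) (xi : dualreg) (x : kspace R^c (R^c)^o) :
  k^o := (xi : modhom _ _) ((r : R) * (x : R) : R).

Fact dualreg_scale_is_linear r xi : linear (dualreg_scale_fun r xi).
Proof.
move=> a x y; rewrite /dualreg_scale_fun -linearP; congr (hom_fun _ _).
rewrite [LHS](mulrDr (r : R)); congr (_ + _).
exact: (mulrA (r : R) (x : R) (alg_unit R a)).
Qed.

HB.instance Definition _ r xi := GRing.isLinear.Build k (kspace R^c (R^c)^o) k^o
  *:%R (dualreg_scale_fun r xi) (dualreg_scale_is_linear r xi).

Definition dualreg_scale (r : R^c) (xi : dualreg) : dualreg :=
  dualreg_scale_fun r xi : {linear kspace R^c (R^c)^o -> k^o}.

Fact dualreg_scaleA a b v :
  dualreg_scale a (dualreg_scale b v) = dualreg_scale (a * b) v.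
Proof.
apply: homP => x; rewrite /= /dualreg_scale_fun /= /dualreg_scale_fun.
by congr (hom_fun _ _); exact: (mulrA (b : R)).
Qed.
Fact dualreg_scale1 : left_id 1 dualreg_scale.
Proof.
move=> v; apply: homP => x /=; rewrite /dualreg_scale_fun.
by congr (hom_fun _ _); exact: (mul1r (x : R)).
Qed.
Fact dualreg_scaleDr : right_distributive dualreg_scale +%R.
Proof. by move=> a u v; apply: homP. Qed.
Fact dualreg_scaleDl v : {morph dualreg_scale^~ v : a b / a + b}.
Proof.
move=> a b; apply: homP => x; rewrite /= /dualreg_scale_fun -linearD.
by congr (hom_fun _ _); exact: (mulrDl (a : R)).
Qed.

HB.instance Definition _ := GRing.Zmodule_isLmodule.Build R^c dualreg
  dualreg_scaleA dualreg_scale1 dualreg_scaleDr dualreg_scaleDl.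
End DualRegular.

(* X (x)_R M, for a right module X and a left module M, as the free commutative
   monoid on X x M modulo the congruence [teq] generated by the usual
   relations; the sequence [:: (x1, m1); ...; (xn, mn)] stands for
   x1 (x) m1 + ... + xn (x) mn.  Opposites exist in the quotient since
   (x, m) + (- x, m) = (0, m) = 0, so this is the tensor product as a group. *)
Section Tensor.
Variables (R : pzRingType) (X : lmodType R^c) (M : lmodType R).
Implicit Types (s t u v : seq (X * M)).

Inductive teq : seq (X * M) -> seq (X * M) -> Prop :=
| teq_refl s : teq s s
| teq_sym s t : teq s t -> teq t s
| teq_trans s t u : teq s t -> teq t u -> teq s u
| teq_cat s t u v : teq s t -> teq u v -> teq (s ++ u) (t ++ v)
| teq_catC s t : teq (s ++ t) (t ++ s)
| teq_0l m : teq [:: (0, m)] [::]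
| teq_Dl x y m : teq [:: (x + y, m)] [:: (x, m); (y, m)]
| teq_Dr x m n : teq [:: (x, m + n)] [:: (x, m); (x, n)]
| teq_balanced x (r : R) m : teq [:: ((r : R^c) *: x, m)] [:: (x, r *: m)].

Definition teqb s t : bool := `[< teq s t >].

Fact teqb_refl : reflexive teqb.
Proof. by move=> s; apply/asboolP; exact: teq_refl. Qed.
Fact teqb_sym : symmetric teqb.
Proof.
by move=> s t; apply/asboolP/asboolP => st; exact: teq_sym.
Qed.
Fact teqb_trans : transitive teqb.
Proof.
by move=> t s u /asboolP st /asboolP tu; apply/asboolP; exact: teq_trans st tu.
Qed.

Canonical teq_equiv := EquivRel teqb teqb_refl teqb_sym teqb_trans.

Definition tensor : Type := {eq_quot teqb}.

HB.instance Definition _ := Choice.on tensor.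
HB.instance Definition _ := EqQuotient.on tensor.

Definition tclass s : tensor := \pi_tensor s.
Definition tens (x : X) (m : M) : tensor := tclass [:: (x, m)].

Lemma tclassP s t : tclass s = tclass t <-> teq s t.
Proof.
by split=> [/eqmodP /asboolP //|st]; apply/eqmodP/asboolP.
Qed.

Lemma tclass_repr (a : tensor) : tclass (repr a) = a.
Proof. exact: reprK. Qed.

Definition topp s : seq (X * M) := [seq (- p.1, p.2) | p <- s].

Definition tensor_zero : tensor := tclass [::].
Definition tensor_add (a b : tensor) : tensor := tclass (repr a ++ repr b).
Definition tensor_opp (a : tensor) : tensor := tclass (topp (repr a)).

Lemma tensor_addE s t : tensor_add (tclass s) (tclass t) = tclass (s ++ t).
Proof. by apply/tclassP; apply: teq_cat; apply/tclassP; exact: tclass_repr. Qed.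

Lemma teq_map (f : X -> X) :
    {morph f : x y / x + y} -> (forall (r : R^c) x, f (r *: x) = r *: f x) ->
  forall s t, teq s t ->
    teq [seq (f p.1, p.2) | p <- s] [seq (f p.1, p.2) | p <- t].
Proof.
move=> fD fZ s t; elim=> {s t} /=.
- by move=> s; exact: teq_refl.
- by move=> s t _; exact: teq_sym.
- by move=> s t u _ st _; exact: teq_trans.
- by move=> s t u v _ st _ uv; rewrite !map_cat; exact: teq_cat.
- by move=> s t; rewrite !map_cat; exact: teq_catC.
- move=> m; move: (fZ 0 0); rewrite !scale0r => ->.
  exact: teq_0l.
- by move=> x y m; rewrite fD; exact: teq_Dl.
- by move=> x m n; exact: teq_Dr.
- by move=> x r m; rewrite fZ; exact: teq_balanced.
Qed.

Lemma teq_catN s : teq (topp s ++ s) [::].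
Proof.
elim: s => [|[x m] s IHs] /=; first exact: teq_refl.
have swap : teq ((- x, m) :: topp s ++ (x, m) :: s)
                ([:: (- x, m); (x, m)] ++ (topp s ++ s)).
  rewrite -cat1s -[(x, m) :: s]cat1s -[[:: (- x, m); _]]cat1s -!catA.
  apply: teq_cat (teq_refl _) _; rewrite !catA.
  by apply: teq_cat (teq_refl _); exact: teq_catC.
apply: teq_trans swap _; rewrite -[[::]]cat0s; apply: teq_cat IHs.
apply: teq_trans (teq_0l m); apply: teq_sym.
by rewrite -(addNr x); exact: teq_Dl.
Qed.

Fact tensor_addA : associative tensor_add.
Proof.
move=> a b c; rewrite -(tclass_repr a) -(tclass_repr b) -(tclass_repr c).
by rewrite !tensor_addE catA.
Qed.
Fact tensor_addC : commutative tensor_add.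
Proof.
move=> a b; rewrite -(tclass_repr a) -(tclass_repr b) !tensor_addE.
by apply/tclassP; exact: teq_catC.
Qed.
Fact tensor_add0 : left_id tensor_zero tensor_add.
Proof.
by move=> a; rewrite -(tclass_repr a) tensor_addE.
Qed.
Fact tensor_addN : left_inverse tensor_zero tensor_opp tensor_add.
Proof.
move=> a; rewrite -{2}(tclass_repr a) tensor_addE.
by apply/tclassP; exact: teq_catN.
Qed.

HB.instance Definition _ :=
  GRing.isZmodule.Build tensor tensor_addA tensor_addC tensor_add0 tensor_addN.
End Tensor.

(* nu_R M = DR (x)_R M, with r (xi (x) m) = (r xi) (x) m. *)
Section Nakayama.
Variables (k : fieldType) (R : centralAlgType k) (M : lmodType R).

Definition nakayama : Type := tensor (dualreg R) M.

HB.instance Definition _ := GRing.Zmodule.on nakayama.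

Definition dual_act (r : R) (xi : dualreg R) : dualreg R :=
  r *: (xi : dual (R^c)^o).

Definition nak_act (r : R) (s : seq (dualreg R * M)) : seq (dualreg R * M) :=
  [seq (dual_act r p.1, p.2) | p <- s].

Definition nak_scale (r : R) (a : nakayama) : nakayama :=
  tclass (nak_act r (repr (a : tensor (dualreg R) M))).

Lemma nak_addE (s t : seq (dualreg R * M)) :
  (tclass s : nakayama) + (tclass t : nakayama) = tclass (s ++ t).
Proof. exact: tensor_addE. Qed.

Lemma dual_actD r : {morph dual_act r : x y / x + y}.
Proof. by move=> x y; exact: (scalerDr r (x : dual (R^c)^o) y). Qed.

Lemma dual_actZ r (a : R^c) xi : dual_act r (a *: xi) = a *: dual_act r xi.
Proof.
apply: homP => x; rewrite /= /dual_scale_fun /= /dualreg_scale_fun /=.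
rewrite /dual_scale_fun.
by congr (hom_fun _ _); exact: (mulrA (a : R)).
Qed.

Lemma nak_scaleE r s : nak_scale r (tclass s) = tclass (nak_act r s).
Proof.
apply/tclassP; apply: teq_map; [exact: dual_actD | exact: dual_actZ |].
by apply/tclassP; exact: tclass_repr.
Qed.

Fact nak_scaleA a b v : nak_scale a (nak_scale b v) = nak_scale (a * b) v.
Proof.
rewrite -(tclass_repr v) !nak_scaleE /nak_act -map_comp; congr tclass.
apply: eq_map => -[xi m] /=; congr pair.
exact: (scalerA a b (xi : dual (R^c)^o)).
Qed.
Fact nak_scale1 : left_id 1 nak_scale.
Proof.
move=> v; rewrite -(tclass_repr v) nak_scaleE /nak_act; congr tclass.
rewrite -[RHS]map_id; apply: eq_map => -[xi m] /=; congr pair.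
exact: (scale1r (xi : dual (R^c)^o)).
Qed.
Fact nak_scaleDr : right_distributive nak_scale +%R.
Proof.
move=> a u v; rewrite -(tclass_repr u) -(tclass_repr v).
by rewrite nak_addE !nak_scaleE nak_addE /nak_act map_cat.
Qed.
Fact nak_scaleDl v : {morph nak_scale^~ v : a b / a + b}.
Proof.
move=> a b; rewrite -(tclass_repr v) !nak_scaleE nak_addE.
apply/tclassP; elim: (repr _) => [|[xi m] s IHs] /=; first exact: teq_refl.
rewrite [dual_act (a + b) xi](scalerDl (xi : dual (R^c)^o) a b).
have swap : teq ([:: (dual_act a xi, m); (dual_act b xi, m)] ++
                 (nak_act a s ++ nak_act b s))
    ((dual_act a xi, m) :: nak_act a s ++ (dual_act b xi, m) :: nak_act b s).
  rewrite -cat1s -[_ :: nak_act a s ++ _]cat1s -[_ :: nak_act b s]cat1s -!catA.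
  apply: teq_cat (teq_refl _) _; rewrite !catA.
  by apply: teq_cat (teq_refl _); exact: teq_catC.
apply: teq_trans swap; rewrite -[_ :: nak_act (a + b) s]cat1s.
by apply: teq_cat IHs; exact: teq_Dl.
Qed.

HB.instance Definition _ := GRing.Zmodule_isLmodule.Build R nakayama
  nak_scaleA nak_scale1 nak_scaleDr nak_scaleDl.
End Nakayama.

(* The matrix algebra (R X; 0 k): ((r, x), c) is the matrix with diagonal
   entries r, c and upper right entry x; k acts on X on the right through the
   structure morphism of R. *)
Section OnePointExtension.
Variables (k : fieldType) (R : centralAlgType k) (X : lmodType R).

Definition one_point : Type := (R * X * k)%type.

HB.instance Definition _ := GRing.Zmodule.on one_point.

Definition ope_one : one_point := (1, 0, 1).
Definition ope_mul (a b : one_point) : one_point :=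
  (a.1.1 * b.1.1, a.1.1 *: b.1.2 + alg_unit R b.2 *: a.1.2, a.2 * b.2).

Fact ope_mulA : associative ope_mul.
Proof.
move=> [[a x] c] [[a' x'] c'] [[a'' x''] c'']; rewrite /ope_mul /= !mulrA.
congr (_, _, _); rewrite !scalerDr !scalerA -!addrA; congr (_ + (_ + _)).
  by rewrite alg_unitC.
by rewrite -rmorphM mulrC.
Qed.
Fact ope_mul1 : left_id ope_one ope_mul.
Proof.
by move=> [[a x] c]; rewrite /ope_mul /= !mul1r scale1r scaler0 addr0.
Qed.
Fact ope_mulr1 : right_id ope_one ope_mul.
Proof.
by move=> [[a x] c]; rewrite /ope_mul /= !mulr1 scaler0 add0r rmorph1 scale1r.
Qed.
Fact ope_mulDl : left_distributive ope_mul +%R.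
Proof.
move=> [[a x] c] [[a' x'] c'] [[a'' x''] c''].
rewrite /ope_mul /= !mulrDl; congr (_, _, _).
by rewrite /= scalerDl scalerDr addrACA.
Qed.
Fact ope_mulDr : right_distributive ope_mul +%R.
Proof.
move=> [[a x] c] [[a' x'] c'] [[a'' x''] c''].
rewrite /ope_mul /= !mulrDr; congr (_, _, _).
by rewrite /= rmorphD scalerDl scalerDr addrACA.
Qed.

HB.instance Definition _ := GRing.Zmodule_isPzRing.Build one_point
  ope_mulA ope_mul1 ope_mulr1 ope_mulDl ope_mulDr.

Definition ope_unit (c : k) : one_point := (alg_unit R c, 0, c).

Fact ope_unit_is_zmod_morphism : zmod_morphism ope_unit.
Proof.
move=> a b; rewrite /ope_unit rmorphB; congr (_, _, _).
by rewrite /= subr0.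
Qed.
Fact ope_unit_is_monoid_morphism : monoid_morphism ope_unit.
Proof.
split=> [|a b]; first by rewrite /ope_unit rmorph1.
rewrite /ope_unit rmorphM; congr (_, _, _).
by rewrite /= !scaler0 addr0.
Qed.
Fact ope_unitC c (a : one_point) : ope_unit c * a = a * ope_unit c.
Proof.
case: a => [[a x] d]; congr (_, _, _) => /=.
- exact: alg_unitC.
- by rewrite !scaler0 addr0 add0r.
- exact: mulrC.
Qed.

HB.instance Definition _ := isCentralAlg.Build k one_point
  ope_unit_is_zmod_morphism ope_unit_is_monoid_morphism ope_unitC.

Definition ope_proj (a : one_point) : R := a.1.1.

Fact ope_proj_is_zmod_morphism : zmod_morphism ope_proj.
Proof. by []. Qed.
Fact ope_proj_is_monoid_morphism : monoid_morphism ope_proj.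
Proof. by []. Qed.

HB.instance Definition _ := GRing.isZmodMorphism.Build one_point R ope_proj
  ope_proj_is_zmod_morphism.
HB.instance Definition _ := GRing.isMonoidMorphism.Build one_point R ope_proj
  ope_proj_is_monoid_morphism.

(* U = e_R A as an R-A-bimodule, for A = R[X] and e_R the identity of R.  The
   identity of R is an idempotent of A, so e_R A = {a | e_R a = a}. *)
Definition ope_corner (r : R) : one_point := (r, 0, 0).

Definition ope_row_pred : {pred one_point} :=
  [pred a | ope_corner 1 * a == a].

Fact ope_row_zmod_closed : zmod_closed ope_row_pred.
Proof.
split=> [|a b]; rewrite !inE ?mulr0 // => /eqP ea /eqP eb.
by rewrite mulrBr ea eb.
Qed.
HB.instance Definition _ :=
  GRing.isZmodClosed.Build one_point ope_row_pred ope_row_zmod_closed.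

Record ope_row : Type := OpeRow { ope_row_val :> one_point; _ : ope_row_val \in ope_row_pred }.

HB.instance Definition _ := [isSub for ope_row_val].
HB.instance Definition _ := [Choice of ope_row by <:].
HB.instance Definition _ := [SubChoice_isSubZmodule of ope_row by <:].

Lemma ope_cornerM r s : ope_corner r * ope_corner s = ope_corner (r * s).
Proof. by congr (_, _, _); rewrite /= ?scaler0 ?addr0 ?mulr0. Qed.

Fact ope_row_lmul_subproof r (u : ope_row) : ope_corner r * val u \in ope_row_pred.
Proof. by rewrite inE mulrA ope_cornerM mul1r. Qed.
Definition ope_row_lmul r (u : ope_row) : ope_row :=
  OpeRow (ope_row_lmul_subproof r u).

Fact ope_row_rmul_subproof (u : ope_row) a : val u * a \in ope_row_pred.
Proof. by rewrite inE mulrA (eqP (valP u)). Qed.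
Definition ope_row_rmul (u : ope_row) (a : one_point) : ope_row :=
  OpeRow (ope_row_rmul_subproof u a).

Fact ope_row_scaleA a b v : ope_row_lmul a (ope_row_lmul b v) = ope_row_lmul (a * b) v.
Proof. by apply: val_inj; rewrite /= mulrA ope_cornerM. Qed.
Fact ope_row_scale1 : left_id 1 ope_row_lmul.
Proof. by move=> v; apply: val_inj; rewrite /= (eqP (valP v)). Qed.
Fact ope_row_scaleDr : right_distributive ope_row_lmul +%R.
Proof. by move=> a u v; apply: val_inj; exact: mulrDr. Qed.
Fact ope_row_scaleDl v : {morph ope_row_lmul^~ v : a b / a + b}.
Proof.
move=> a b; apply: val_inj; rewrite /= -mulrDl; congr (_ * _).
by congr (_, _, _); rewrite /= addr0.
Qed.

HB.instance Definition _ := GRing.Zmodule_isLmodule.Build R ope_row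
  ope_row_scaleA ope_row_scale1 ope_row_scaleDr ope_row_scaleDl.
End OnePointExtension.

(* The functor Hom_R(U, -) : mod R -> mod A on objects, with
   (a f) u = f (u a). *)
Section HomRow.
Variables (k : fieldType) (R : centralAlgType k) (X M : lmodType R).

Definition hom_row : Type := modhom (ope_row X) M.

HB.instance Definition _ := GRing.Zmodule.on hom_row.

Definition hom_row_scale_fun (a : one_point X) (f : hom_row) (u : ope_row X) : M :=
  (f : modhom _ _) (ope_row_rmul u a).

Fact hom_row_scale_is_linear a f : linear (hom_row_scale_fun a f).
Proof.
move=> r u v; rewrite /hom_row_scale_fun -linearP; congr (hom_fun _ _).
by apply: val_inj; rewrite /= mulrDl -mulrA.
Qed.

HB.instance Definition _ a f := GRing.isLinear.Build R (ope_row X) M *:%R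
  (hom_row_scale_fun a f) (hom_row_scale_is_linear a f).

Definition hom_row_scale (a : one_point X) (f : hom_row) : hom_row :=
  hom_row_scale_fun a f : {linear ope_row X -> M}.

Fact hom_row_scaleA a b v : hom_row_scale a (hom_row_scale b v) = hom_row_scale (a * b) v.
Proof.
apply: homP => u; rewrite /= /hom_row_scale_fun /= /hom_row_scale_fun.
by congr (hom_fun _ _); apply: val_inj; rewrite /= mulrA.
Qed.
Fact hom_row_scale1 : left_id 1 hom_row_scale.
Proof.
move=> v; apply: homP => u; rewrite /= /hom_row_scale_fun.
by congr (hom_fun _ _); apply: val_inj; rewrite /= mulr1.
Qed.
Fact hom_row_scaleDr : right_distributive hom_row_scale +%R.
Proof. by move=> a u v; apply: homP. Qed.
Fact hom_row_scaleDl v : {morph hom_row_scale^~ v : a b / a + b}.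
Proof.
move=> a b; apply: homP => u; rewrite /= /hom_row_scale_fun -linearD.
by congr (hom_fun _ _); apply: val_inj; rewrite /= mulrDr.
Qed.

HB.instance Definition _ := GRing.Zmodule_isLmodule.Build (one_point X) hom_row
  hom_row_scaleA hom_row_scale1 hom_row_scaleDr hom_row_scaleDl.
End HomRow.

Section ModulePredicates.
Variable R : pzRingType.
Implicit Types (M N P : lmodType R).

Definition iso M N : Prop := exists f : {linear M -> N}, bijective f.

Definition surj (U V : Type) (f : U -> V) : Prop := forall y, exists x, f x = y.

Definition fin_gen M : Prop :=
  exists (n : nat) (g : 'I_n -> M),
    forall x, exists c : 'I_n -> R, x = \sum_(i < n) c i *: g i.

Definition projective P : Prop :=
  forall M N (g : {linear M -> N}) (f : {linear P -> N}), surj g ->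
    exists h : {linear P -> M}, forall x, g (h x) = f x.

Definition zero_mod M : Prop := forall x : M, x = 0.

Definition indecomposable M : Prop :=
  ~ zero_mod M /\
  forall N N', iso M (N * N')%type -> zero_mod N \/ zero_mod N'.

Definition summand N M : Prop := exists N', iso M (N * N')%type.

(* |M| = n *)
Definition num_indec M (n : nat) : Prop :=
  exists X : 'I_n -> lmodType R,
    [/\ forall i, indecomposable (X i) /\ summand (X i) M,
        forall i j, iso (X i) (X j) -> i = j &
        forall N, indecomposable N -> summand N M -> exists i, iso N (X i)].

Definition maximal_submod M (L : {pred M}) : Prop :=
  [/\ submod_closed L, exists x, x \notin L &
      forall L' : {pred M}, submod_closed L' -> {subset L <= L'} ->
        {subset L' <= L} \/ forall x, x \in L'].

Definition in_radical M (x : M) : Prop :=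
  forall L : {pred M}, maximal_submod L -> x \in L.

(* S is isomorphic to M / rad M. *)
Definition is_top (M S : lmodType R) : Prop :=
  exists f : {linear M -> S}, surj f /\ forall x, f x = 0 <-> in_radical x.

Definition superfluous M (K : {pred M}) : Prop :=
  forall L : {pred M}, submod_closed L ->
    (forall x, exists y z, [/\ y \in K, z \in L & x = y + z]) ->
  forall x, x \in L.

Definition kernel M N (f : {linear M -> N}) : {pred M} := [pred x | f x == 0].

(* P1 -> P0 -> M -> 0 is exact with P0 -> M and P1 -> Ker(P0 -> M) projective
   covers. *)
Definition min_proj_presentation P1 P0 M
    (p1 : {linear P1 -> P0}) (p0 : {linear P0 -> M}) : Prop :=
  [/\ fin_gen P0 /\ projective P0, fin_gen P1 /\ projective P1,
      surj p0 /\ (forall x, p0 x = 0 <-> exists y, p1 y = x),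
      superfluous (kernel p0) & superfluous (kernel p1)].

(* X is isomorphic to Tr M, the cokernel of Hom(P0, R) -> Hom(P1, R). *)
Definition is_transpose M (X : lmodType R^c) : Prop :=
  exists (P1 P0 : lmodType R) (p1 : {linear P1 -> P0}) (p0 : {linear P0 -> M}),
    min_proj_presentation p1 p0 /\
    exists q : {linear homreg P1 -> X},
      surj q /\
      forall g : homreg P1, q g = 0 <->
        exists f : homreg P0, g = hom_comp (f : modhom P0 R^o) (p1 : modhom P1 P0).
End ModulePredicates.

Section TauTilting.
Variables (k : fieldType) (R : centralAlgType k) (T : lmodType R).

(* Hom(T, tau T) = 0, with tau T = D Tr T. *)
Definition tau_rigid : Prop :=
  exists X : lmodType R^c,
    is_transpose T X /\ forall (f : {linear T -> dual X}) (x : T), f x = 0.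

Definition tau_tilting : Prop :=
  [/\ fin_gen T, tau_rigid & exists n, num_indec T n /\ num_indec (R^o) n].
End TauTilting.

Section Basic.
Variable R : pzRingType.

Definition idempotent_elt (e : R) : Prop := e * e = e.

Definition primitive_idempotent (e : R) : Prop :=
  [/\ idempotent_elt e, e != 0 &
      forall f g : R, idempotent_elt f -> idempotent_elt g ->
        f * g = 0 -> g * f = 0 -> e = f + g -> f = 0 \/ g = 0].

(* The left ideal R e of an idempotent e is {x | x e = x}. *)
Definition left_ideal_pred (e : R) : {pred R^o} := [pred x : R | x * e == x].

Fact left_ideal_submod_closed e : submod_closed (left_ideal_pred e).
Proof.
split=> [|a x y]; rewrite !inE ?mul0r // => /eqP ex /eqP ey.
by rewrite mulrDl ey -[a *: x]/(a * x) -mulrA ex.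
Qed.
HB.instance Definition _ e := GRing.isSubmodClosed.Build R R^o
  (left_ideal_pred e) (left_ideal_submod_closed e).

Record left_ideal (e : R) : Type :=
  LeftIdeal { left_ideal_val :> R^o; _ : left_ideal_val \in left_ideal_pred e }.

HB.instance Definition _ e := [isSub for @left_ideal_val e].
HB.instance Definition _ e := [Choice of left_ideal e by <:].
HB.instance Definition _ e := [SubChoice_isSubLmodule of left_ideal e by <:].

Definition basic_ring : Prop :=
  exists (n : nat) (e : 'I_n -> R),
    [/\ forall i, primitive_idempotent (e i),
        forall i j, i != j -> e i * e j = 0,
        \sum_(i < n) e i = 1 &
        forall i j, iso (left_ideal (e i)) (left_ideal (e j)) -> i = j].
End Basic.

(* Main.v *)
(* Let e be the vertex of A = B[P0] outside B.  An indecomposable projective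
   A-module is either killed by e, hence a projective B-module, or isomorphic to
   A e, whose top is k with A acting through its last diagonal entry; so S is
   this one-dimensional module.  As Hom_A(S, E T) = 0 and E is fully faithful,
   End_A(E T + S) is triangular with diagonal entries End_B(T) and k.  An
   A-linear map E T -> S is a k-linear form on e (E T) = Hom_B(P0, T), and for a
   dual basis (p_i, phi_i) of P0 the trace
     g |-> (h |-> \sum_i <phi_i, g (h p_i)>),  <phi, xi (x) x> = xi (phi x),
   identifies Hom_B(T, nu P0) with the dual of Hom_B(P0, T). *)
Require Import Defs.
From HB Require Import structures.
From mathcomp Require Import all_boot all_order all_algebra all_field.
From mathcomp Require Import boolp.
Set Implicit Arguments.
Unset Strict Implicit.
Unset Printing Implicit Defensive.
Import GRing.Theory.
Local Open Scope ring_scope.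

(** * Bijections, linear maps and dual bases of projective modules *)

Lemma inj_surj_bijective (U V : Type) (f : U -> V) :
  injective f -> surj f -> bijective f.
Proof.
move=> fI /choice [g fK]; exists g => // x.
by apply: fI; rewrite fK.
Qed.

Definition linear_of (R : pzRingType) (M N : lmodType R) (f : M -> N)
    (fl : linear f) : {linear M -> N} :=
  HB.pack f (GRing.isLinear.Build R M N *:%R f fl).

(** Generators give a surjection from the free module R^n, and projectivity lifts the identity of P
    to a section [s]; the coordinates of [s] are the [phi i]. *)
Lemma projective_dual_basis (R : pzRingType) (P : lmodType R) :
  fin_gen P -> projective P ->
  exists (n : nat) (p : 'I_n -> P) (phi : 'I_n -> homreg P),
    forall x, x = \sum_(i < n) ((phi i : modhom P R^o) x : R) *: p i.
Proof.
move=> [n [p gen]] proj.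
pose comb (c : {ffun 'I_n -> R^o}) : P := \sum_(i < n) (c i : R) *: p i.
have comb_lin : linear comb.
  move=> a c d; rewrite /comb scaler_sumr -big_split /=.
  by apply: eq_bigr => i _; rewrite !ffunE scalerDl scalerA.
have comb_surj : surj (linear_of comb_lin).
  move=> x; have [c ->] := gen x; exists [ffun i => c i].
  by apply: eq_bigr => i _; rewrite ffunE.
have [s sK] := proj _ _ (linear_of comb_lin) idfun comb_surj.
have coord_lin i : linear (fun x => s x i : R^o).
  by move=> a x y; rewrite linearP !ffunE.
exists n, p, (fun i => linear_of (coord_lin i)) => x.
by rewrite -[LHS](sK x).
Qed.

(** * Idempotent endomorphisms of indecomposable modules *)

Section Idempotent.
Variables (R : pzRingType) (M : lmodType R).

Section Kernel.
Variables (N : lmodType R) (f : {linear M -> N}).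

Fact kernel_submod_closed : submod_closed (kernel f).
Proof.
split=> [|a x y]; rewrite !inE ?linear0 // => /eqP fx /eqP fy.
by rewrite linearP fx fy scaler0 addr0.
Qed.
HB.instance Definition _ := GRing.isSubmodClosed.Build R M
  (kernel f) kernel_submod_closed.

(** The kernel becomes a module of its own, because [indecomposable] speaks of products of modules
    and not of submodules. *)
Record kernel_mod : Type := KernelMod
  { kernel_mod_val :> M; _ : kernel_mod_val \in kernel f }.

HB.instance Definition _ := [isSub for kernel_mod_val].
HB.instance Definition _ := [Choice of kernel_mod by <:].
HB.instance Definition _ := [SubChoice_isSubLmodule of kernel_mod by <:].
End Kernel.

(** M is the direct sum of im eps = ker (1 - eps) and ker eps, so one of the two vanishes. *)
Lemma indecomposable_idempotent (eps : {linear M -> M}) :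
  indecomposable M -> (forall x, eps (eps x) = eps x) ->
  (forall x, eps x = 0) \/ (forall x, eps x = x).
Proof.
move=> [_ indec] epsK.
have comp_lin : linear (fun x => x - eps x).
  by move=> a x y; rewrite linearP scalerBr opprD addrACA.
pose cps := linear_of comp_lin.
have inK x : x - eps x \in kernel eps by rewrite inE linearB epsK subrr.
have inC x : eps x \in kernel cps.
  by rewrite inE /= epsK subrr.
pose d x : (kernel_mod cps * kernel_mod eps)%type :=
  (KernelMod (inC x), KernelMod (inK x)).
have d_lin : linear d.
  move=> a x y; congr (_, _); apply: val_inj => /=; first exact: linearP.
  exact: comp_lin.
have [|cps0|eps0] := indec (kernel_mod cps) (kernel_mod eps).
- exists (linear_of d_lin); exists (fun yz => val yz.1 + val yz.2).
    by move=> x /=; rewrite addrC subrK.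
  move=> [[y yP] [z zP]].
  have ey : y = eps y by apply/eqP; rewrite -subr_eq0; exact: yP.
  have ez : eps z = 0 by apply/eqP; exact: zP.
  congr (_, _); apply: val_inj => /=.
    by rewrite linearD ez addr0 -ey.
  by rewrite linearD ez addr0 -ey addrC addKr.
- by left=> x; exact: (congr1 val (cps0 (KernelMod (inC x)))).
- right=> x; symmetry; apply/eqP; rewrite -subr_eq0; apply/eqP.
  exact: (congr1 val (eps0 (KernelMod (inK x)))).
Qed.
End Idempotent.

(** * The one-dimensional module at the extension vertex *)

Section Vertex.
Variables (k : fieldType) (R : centralAlgType k) (X : lmodType R).

Definition ope_last (a : one_point X) : k := a.2.

Fact ope_last_is_zmod_morphism : zmod_morphism ope_last.
Proof. by []. Qed.
Fact ope_last_is_monoid_morphism : monoid_morphism ope_last.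
Proof. by []. Qed.
HB.instance Definition _ := GRing.isZmodMorphism.Build (one_point X) k ope_last
  ope_last_is_zmod_morphism.
HB.instance Definition _ := GRing.isMonoidMorphism.Build (one_point X) k ope_last
  ope_last_is_monoid_morphism.

Definition vertex : lmodType (one_point X) := restr ope_last k^o.

(** For c = 1 this is the idempotent e of the extension vertex; in general it is c e. *)
Definition ope_scal (c : k) : one_point X := (0, 0, c).

(** The bottom row of a matrix has only its diagonal entry, so e A = k e. *)
Lemma ope_scalM c (a : one_point X) : ope_scal c * a = ope_scal (c * a.2).
Proof. by congr (_, _, _); rewrite /= ?mul0r // scale0r scaler0 addr0. Qed.

End Vertex.

(** * The indecomposable projective that does not come from R, and its top *)

Section VertexProjective.
Variables (k : fieldType) (R : centralAlgType k) (X : lmodType R).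
Local Notation A := (one_point X).
Local Notation e := (@ope_scal k R X 1).
Variable P : lmodType A.

(* A module killed by [e] is a module over R = A / A e, and lifting problems
   over R are lifting problems over A. *)
Lemma vertex_killed_restr : projective P -> (forall x : P, e *: x = 0) ->
  exists Q : lmodType R, projective Q /\ iso P (restr (@ope_proj k R X) Q).
Proof.
move=> proj eP0.
have cornerE (a : A) (x : P) : a *: x = ope_corner X a.1.1 *: x.
  (* The last column of [a] is [a * e], which kills P; only the entry in R acts. *)
  have aE : a = ope_corner X a.1.1 + a * e.
    case: a => [[r y] c]; congr (_, _, _); rewrite /=.
    - by rewrite mulr0 addr0.
    - by rewrite add0r scaler0 add0r rmorph1 scale1r.
    - by rewrite add0r mulr1.
  by rewrite {1}aE scalerDl -scalerA eP0 scaler0 addr0.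
pose scale (r : R) (x : P) : P := ope_corner X r *: x.
have scaleA r s x : scale r (scale s x) = scale (r * s) x.
  by rewrite /scale scalerA ope_cornerM.
have scale1 : left_id 1 scale.
  by move=> x; rewrite /scale -(cornerE 1) scale1r.
have scaleDr : right_distributive scale +%R by move=> r x y; exact: scalerDr.
have scaleDl x : {morph scale^~ x : r s / r + s}.
  move=> r s; rewrite /scale -scalerDl; congr (_ *: _).
  by congr (_, _, _); rewrite /= addr0.
pose Q : lmodType R := HB.pack (GRing.Zmodule.sort P)
  (GRing.Zmodule_isLmodule.Build R (GRing.Zmodule.sort P)
     scaleA scale1 scaleDr scaleDl).
exists Q; split; last first.
  have id_lin : linear (idfun : P -> restr (@ope_proj k R X) Q).
    by move=> a x y; congr (_ + _); exact: cornerE.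
  by exists (linear_of id_lin); exists idfun.
move=> M N g f gsurj.
have g_lin : linear (g : restr (@ope_proj k R X) M -> restr (@ope_proj k R X) N).
  by move=> a x y; exact: linearP.
have f_lin : linear (f : P -> restr (@ope_proj k R X) N).
  move=> a x y; rewrite cornerE.
  exact: (linearP f a.1.1 (x : Q) (y : Q)).
have [h hE] := proj _ _ (linear_of g_lin) (linear_of f_lin) gsurj.
have h_lin : linear (h : Q -> M).
  move=> r x y; exact: (linearP h (ope_corner X r) x y).
by exists (linear_of h_lin).
Qed.

Hypotheses (Pfg : fin_gen P) (Pproj : projective P) (Pind : indecomposable P).
Hypothesis PnR : ~ exists Q : lmodType R,
  projective Q /\ iso P (restr (@ope_proj k R X) Q).

(* P is isomorphic to A e, through the coordinate function [f]. *)
Lemma vertex_projective : exists (p : P) (f : {linear P -> A^o}),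
  (f p : A) = e /\ forall x, x = (f x : A) *: p.
Proof.
have [n [q [phi qE]]] := projective_dual_basis Pfg Pproj.
(* If all coordinates had last entry 0, then e would kill P by the dual basis expansion, against
   [PnR]. *)
have [phi0|] := pselect (forall i x, ((phi i : modhom P A^o) x : A).2 = 0).
  case: PnR; apply: vertex_killed_restr => // x.
  rewrite [x]qE scaler_sumr big1 // => i _.
  by rewrite scalerA ope_scalM phi0 mulr0 (_ : ope_scal _ 0 = 0) ?scale0r.
move=> /existsNP [i /existsNP [x /eqP cn0]].
set c := (X in X != 0) in cn0.
(* The coordinate of [x] has last entry [c], so multiplying by c^-1 e normalises it to exactly e. *)
pose p : P := ope_scal X c^-1 *: x.
have fp : ((phi i : modhom P A^o) p : A) = e.
  by rewrite linearZ /= [LHS]ope_scalM mulVf.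
have ep : e *: p = p by rewrite scalerA ope_scalM mul1r.
(* With f = [phi i], the map y |-> (f y) p is idempotent because f p = e and e p = p. *)
have eps_lin : linear (fun y => ((phi i : modhom P A^o) y : A) *: p).
  move=> a y z; rewrite linearP scalerDl; congr (_ + _).
  by rewrite [RHS]scalerA.
have epsK y : linear_of eps_lin (linear_of eps_lin y) = linear_of eps_lin y.
  rewrite /= linearZ /=.
  rewrite -[X in X *: _ = _]/(((phi i : modhom P A^o) y : A) *
    ((phi i : modhom P A^o) p : A)).
  by rewrite fp -scalerA ep.
exists p, (phi i : modhom P A^o); split=> //.
(* The idempotent fixes [p], and [p] is nonzero since f p = e is; hence it is the identity. *)
have [eps0|epsid] := indecomposable_idempotent Pind epsK.
  case/eqP: cn0; have /= := eps0 p; rewrite fp ep => p0.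
  have := congr1 (fun a : A => a.2) fp; rewrite p0 linear0 /= => /esym/eqP.
  by rewrite oner_eq0.
by move=> y; rewrite -[LHS]epsid.
Qed.

(** The kernel [K] of the last coordinate [chi] contains every proper submodule, because an element
    outside [K] generates P; so [K] is the only maximal submodule. *)
Lemma vertex_radical (p : P) (f : {linear P -> A^o}) (x : P) :
  (f p : A) = e -> (forall x, x = (f x : A) *: p) ->
  in_radical x <-> (f x : A).2 = 0.
Proof.
move=> fp fE; pose chi x := (f x : A).2.
have chiD y z : chi (y + z) = chi y + chi z by rewrite /chi linearD.
have chiZ (a : A) y : chi (a *: y) = a.2 * chi y by rewrite /chi linearZ.
have chi0 : chi 0 = 0 by rewrite /chi linear0.
have chip : chi p = 1 by rewrite /chi fp.
pose K : {pred P} := [pred y | chi y == 0].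
have Ksub : submod_closed K.
  split=> [|a y z]; rewrite !inE ?chi0 // => /eqP y0 /eqP z0.
  by rewrite chiD chiZ y0 z0 mulr0 addr0.
have pNK : p \notin K by rewrite inE chip oner_eq0.
(* Since e f(y) = chi(y) e, multiplying y = f(y) p by chi(y)^-1 e yields e p = p. *)
have memp (L : {pred P}) y : submod_closed L -> y \in L -> chi y != 0 -> p \in L.
  move=> [L0 Llin] yL yn0; suff -> : p = ope_scal X (chi y)^-1 *: y + 0 by exact: Llin.
  by rewrite addr0 {2}[y]fE scalerA ope_scalM mulVf // -fp -fE.
have allL (L : {pred P}) : submod_closed L -> p \in L -> forall y, y \in L.
  move=> [L0 Llin] pL y; rewrite [y]fE -[_ *: _]addr0; exact: Llin.
split=> [radx|x0].
  apply/eqP; apply: (radx K); split=> //; first by exists p.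
  move=> L Lsub KL.
  have [[y [yL yn0]]|nL] := pselect (exists y, y \in L /\ chi y != 0).
    by right; apply: allL => //; apply: memp yL yn0.
  left=> y yL; rewrite inE; apply/negP => /negP yn0; apply: nL.
  by exists y.
move=> L [Lsub [z zL] Lmax].
have LK : {subset L <= K}.
  move=> y yL; rewrite inE; apply/negP => /negP yn0.
  by case/negP: zL; apply: allL => //; apply: memp yL yn0.
have [KL|Kall] := Lmax K Ksub LK; first by apply: KL; rewrite inE; apply/eqP.
by have := Kall p; rewrite (negPf pNK).
Qed.

(** The surjections of P onto S and, by the last coordinate, onto k have the same kernel rad P. *)
Lemma top_vertex (S : lmodType A) : is_top P S -> iso (vertex X) S.
Proof.
move=> [g [gsurj gker]]; have [p [f [fp fE]]] := vertex_projective.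
have {gker}gker x : g x = 0 <-> (f x : A).2 = 0.
  exact: iff_trans (gker x) (vertex_radical x fp fE).
have fscal c : (f (ope_scal X c *: p) : A).2 = c.
  rewrite linearZ -[LHS]/(ope_scal X c * (f p : A)).2 fp.
  by rewrite ope_scalM mulr1.
pose io (c : vertex X) : S := g (ope_scal X (c : k) *: p).
have eqg x y : (f x : A).2 = (f y : A).2 -> g x = g y.
  move=> fxy; apply/eqP; rewrite -subr_eq0 -linearB; apply/eqP/gker.
  by rewrite linearB -[LHS]/((f x : A).2 - (f y : A).2) fxy subrr.
have io_lin : linear io.
  move=> a c d; rewrite /io -linearP; apply: eqg.
  by rewrite linearP /= !fscal.
exists (linear_of io_lin); apply: inj_surj_bijective.
  move=> c d /eqP; rewrite -subr_eq0 -linearB => /eqP /gker.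
  by rewrite fscal => /eqP; rewrite subr_eq0 => /eqP.
move=> s; have [x <-] := gsurj s; exists (f x : A).2.
by apply: eqg; rewrite fscal.
Qed.
End VertexProjective.

(** * The pairing between Hom(P, R) and nu P *)

Section NakayamaPairing.
Variables (k : fieldType) (R : centralAlgType k) (P : lmodType R).
Local Notation DR := (dualreg R).
Local Notation "phi $ x" := ((phi : modhom P R^o) x : R) (at level 10).
Implicit Types (phi : homreg P) (w : nakayama P).

Definition dualreg_eval (xi : DR) (r : R) : k :=
  (xi : modhom (kspace R^c (R^c)^o) k^o) (r : (R^c)^o).

Lemma dualreg_evalD xi r s :
  dualreg_eval xi (r + s) = dualreg_eval xi r + dualreg_eval xi s.
Proof. exact: (linearD (xi : modhom (kspace R^c (R^c)^o) k^o)). Qed.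

Lemma dualreg_evalZ xi c r :
  dualreg_eval xi (alg_unit R c * r) = c * dualreg_eval xi r.
Proof.
(* In the k-space underlying the regular module of [R^c], a scalar multiplies on the right. *)
rewrite alg_unitC.
exact: (linearZ_LR (xi : modhom (kspace R^c (R^c)^o) k^o) c r).
Qed.

Definition nak_pair_seq phi (s : seq (DR * P)) : k :=
  \sum_(q <- s) dualreg_eval q.1 (phi $ q.2).

(** Each generating relation is respected; the balanced one because (xi r)(phi x) = xi (r phi x) =
    xi (phi (r x)). *)
Lemma nak_pair_teq phi s t : teq s t -> nak_pair_seq phi s = nak_pair_seq phi t.
Proof.
rewrite /nak_pair_seq; elim=> {s t} //.
- by move=> s t u _ -> _ ->.
- by move=> s t u v _ st _ uv; rewrite !big_cat st uv.
- by move=> s t; rewrite !big_cat; exact: addrC.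
- by move=> m; rewrite big_seq1 big_nil.
- by move=> x y m; rewrite big_cons !big_cons !big_nil !addr0.
- move=> x m n; rewrite !big_cons !big_nil !addr0 /=.
  by rewrite linearD dualreg_evalD.
- by move=> x r m; rewrite !big_seq1 /= linearZ.
Qed.

(* The pairing (phi, xi (x) x) |-> xi (phi x) of Hom(P, R) with DR (x) P. *)
Definition nak_pair phi w : k := nak_pair_seq phi (repr (w : tensor DR P)).

Lemma nak_pairE phi s : nak_pair phi (tclass s) = nak_pair_seq phi s.
Proof. by apply: nak_pair_teq; apply/tclassP; exact: tclass_repr. Qed.

(** A representing list writes any element as a finite sum of pure tensors. *)
Lemma nakayama_ind (K : nakayama P -> Prop) :
  K 0 -> (forall xi x w, K w -> K ((tens xi x : nakayama P) + w)) ->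
  forall w, K w.
Proof.
move=> K0 KD w; rewrite -(tclass_repr w).
elim: (repr _) => [|[xi x] s IHs]; first exact: K0.
by have := KD xi x _ IHs; rewrite nak_addE.
Qed.

Lemma nak_pairD phi v w : nak_pair phi (v + w) = nak_pair phi v + nak_pair phi w.
Proof.
rewrite -(tclass_repr v) -(tclass_repr w) nak_addE !nak_pairE.
exact: big_cat.
Qed.

Lemma nak_pair0 phi : nak_pair phi 0 = 0.
Proof. by rewrite (nak_pairE phi [::]) /nak_pair_seq big_nil. Qed.

Lemma nak_pairB phi v w : nak_pair phi (v - w) = nak_pair phi v - nak_pair phi w.
Proof. by apply: (addIr (nak_pair phi w)); rewrite -nak_pairD !subrK. Qed.

Lemma nak_pair_tens phi xi x :
  nak_pair phi (tens xi x) = dualreg_eval xi (phi $ x).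
Proof. by rewrite nak_pairE /nak_pair_seq big_seq1. Qed.

(** On pure tensors, (r xi)(phi x) = xi (phi x r) = xi ((phi r) x). *)
Lemma nak_pairZ phi r w :
  nak_pair phi (r *: w) = nak_pair ((r : R^c) *: phi) w.
Proof.
rewrite -(tclass_repr w) [r *: _]nak_scaleE !nak_pairE.
by rewrite /nak_pair_seq /nak_act big_map.
Qed.

Lemma nak_pair_alg_unit phi c w :
  nak_pair phi (alg_unit R c *: w) = c * nak_pair phi w.
Proof.
rewrite nak_pairZ; elim/nakayama_ind: w => [|xi x w IHw].
  by rewrite !nak_pair0 mulr0.
rewrite !nak_pairD IHw !nak_pair_tens mulrDr; congr (_ + _).
rewrite -dualreg_evalZ alg_unitC; congr (dualreg_eval _ _).
Qed.

Lemma nak_pairDl phi psi w :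
  nak_pair (phi + psi) w = nak_pair phi w + nak_pair psi w.
Proof.
elim/nakayama_ind: w => [|xi x w IHw]; first by rewrite !nak_pair0 addr0.
by rewrite !nak_pairD IHw !nak_pair_tens addrACA -dualreg_evalD.
Qed.

Lemma nak_pair_suml (I : Type) (s : seq I) (F : I -> homreg P) w :
  nak_pair (\sum_(i <- s) F i) w = \sum_(i <- s) nak_pair (F i) w.
Proof.
apply: (big_morph (nak_pair^~ w)) => [phi psi|]; first exact: nak_pairDl.
by apply: (addrI (nak_pair 0 w)); rewrite -nak_pairDl !addr0.
Qed.

Lemma nak_pair_sumr (I : Type) (s : seq I) (F : I -> nakayama P) phi :
  nak_pair phi (\sum_(i <- s) F i) = \sum_(i <- s) nak_pair phi (F i).
Proof.
by apply: (big_morph (nak_pair phi)) => [v w|]; [exact: nak_pairD|exact: nak_pair0].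
Qed.

Lemma tensDl (xi eta : DR) (x : P) :
  (tens (xi + eta) x : nakayama P) = tens xi x + tens eta x.
Proof. by rewrite [RHS]nak_addE; apply/tclassP; exact: teq_Dl. Qed.

Lemma tensDr (xi : DR) (x y : P) :
  (tens xi (x + y) : nakayama P) = tens xi x + tens xi y.
Proof. by rewrite [RHS]nak_addE; apply/tclassP; exact: teq_Dr. Qed.

Lemma tens_sumr (I : Type) (s : seq I) (F : I -> P) (xi : DR) :
  (tens xi (\sum_(i <- s) F i) : nakayama P) = \sum_(i <- s) (tens xi (F i) : nakayama P).
Proof.
apply: (big_morph (fun x => tens xi x : nakayama P)) => [x y|].
  exact: tensDr.
by apply: (addrI (tens xi 0 : nakayama P)); rewrite -tensDr !addr0.
Qed.

Lemma tens_balanced (xi : DR) (r : R) (x : P) :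
  (tens ((r : R^c) *: xi) x : nakayama P) = tens xi (r *: x).
Proof. by apply/tclassP; exact: teq_balanced. Qed.

Lemma tensZ r (xi : DR) (x : P) :
  r *: (tens xi x : nakayama P) = tens (dual_act r xi) x.
Proof. exact: nak_scaleE. Qed.

End NakayamaPairing.

Lemma hom_sumE (R : pzRingType) (M N : lmodType R) (I : Type) (s : seq I)
    (F : I -> modhom M N) x :
  (\sum_(i <- s) F i : modhom M N) x = \sum_(i <- s) (F i x : N).
Proof. by apply: (big_morph (fun f : modhom M N => f x : N)). Qed.

(** * Trace duality between Hom(T, nu P) and Hom(P, T) *)

Section NakayamaTrace.
Variables (k : fieldType) (R : centralAlgType k) (P T : lmodType R).
Variables (n : nat) (p : 'I_n -> P) (phi : 'I_n -> homreg P).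
Local Notation "f $ x" := ((f : modhom P R^o) x : R) (at level 10).
Hypothesis basis : forall x, x = \sum_(i < n) phi i $ x *: p i.

Local Notation Hom := (kspace (endo P) (homE P T)).

Definition nak_trace_fun (g : homE T (nakayama P)) (h : Hom) : k^o :=
  \sum_(i < n) nak_pair (phi i) ((g : modhom _ _) ((h : modhom P T) (p i))).

Fact nak_trace_linear g : linear (nak_trace_fun g).
Proof.
move=> c h1 h2; rewrite /nak_trace_fun scaler_sumr -big_split /=.
apply: eq_bigr => i _.
rewrite -[X in _ = X + _]nak_pair_alg_unit -[RHS]nak_pairD.
(* A scalar acts on Hom(P, T) by precomposition with a homothety of P; linearity of [h1] moves it
   outside. *)
have -> : (h1 : modhom P T) (homothety c (p i)) =
    alg_unit R c *: (h1 : modhom P T) (p i) by exact: linearZ_LR.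
by rewrite linearD linearZ.
Qed.

Definition nak_trace g : {linear Hom -> k^o} := linear_of (@nak_trace_linear g).

(** These maps span Hom(P, T): by the dual basis, h is the sum of the [rank1 (phi i) (h (p i))]. *)
Definition rank1_fun (f : homreg P) (t : T) (x : P) : T := f $ x *: t.

Fact rank1_linear f t : linear (rank1_fun f t).
Proof.
move=> a x y; rewrite /rank1_fun linearP scalerDl; congr (_ + _).
by rewrite [RHS]scalerA.
Qed.

Definition rank1 (f : homreg P) (t : T) : homE P T := linear_of (@rank1_linear f t).

Lemma rank1D f t u : rank1 f (t + u) = rank1 f t + rank1 f u.
Proof. by apply: homP => x; exact: scalerDr. Qed.

(** For f = [phi i] this is the coefficient in DR of [p i] in the value at t of the map T -> nu P
    whose trace form is [lam]. *)
Definition cotrace_coef_fun (lam : {linear Hom -> k^o}) (f : homreg P) (t : T)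
    (r : kspace R^c (R^c)^o) : k^o := lam (rank1 f ((r : R) *: t)).

Fact cotrace_coef_linear lam f t : linear (cotrace_coef_fun lam f t).
Proof.
move=> c r s; rewrite /cotrace_coef_fun -linearP; congr (lam _).
apply: homP => x; rewrite /= /rank1_fun.
rewrite [X in _ *: X](scalerDl t ((r : R) * alg_unit R c) (s : R)) scalerDr.
congr (_ + _); have -> : f $ (homothety c x) = alg_unit R c * f $ x.
  exact: (linearZ_LR (f : modhom P R^o)).
by rewrite [LHS]scalerA [RHS]scalerA -alg_unitC mulrA -alg_unitC.
Qed.

Definition cotrace_coef lam f t : dualreg R :=
  linear_of (@cotrace_coef_linear lam f t).

Definition cotrace_fun lam (t : T) : nakayama P :=
  \sum_(i < n) (tens (cotrace_coef lam (phi i) t) (p i) : nakayama P).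

Fact cotrace_linear lam : linear (cotrace_fun lam).
Proof.
move=> r t u; rewrite /cotrace_fun scaler_sumr -big_split /=.
apply: eq_bigr => i _; rewrite tensZ -tensDl; congr (tens _ _ : nakayama P).
apply: homP => s /=; rewrite /dual_scale_fun /= /cotrace_coef_fun -linearD.
by congr (lam _); rewrite -rank1D scalerDr scalerA.
Qed.

Definition cotrace lam : homE T (nakayama P) := linear_of (@cotrace_linear lam).

(** The dual basis is used twice: the expansion of [p j] collapses one sum to h (p_j), and that of x
    identifies the sum of the [rank1 (phi j) (h (p j))] with h. *)
Lemma nak_traceK lam h : nak_trace (cotrace lam) h = lam h.
Proof.
rewrite /= /nak_trace_fun /= /cotrace_fun.
under eq_bigr => i _ do
  (rewrite nak_pair_sumr; under eq_bigr => j _ do rewrite nak_pair_tens).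
rewrite exchange_big /=.
transitivity (\sum_(j < n) lam (rank1 (phi j) ((h : modhom P T) (p j)))).
  apply: eq_bigr => j _; rewrite /dualreg_eval /= /cotrace_coef_fun.
  rewrite -linear_sum; congr (lam _); apply: homP => x.
  rewrite hom_sumE /= /rank1_fun -scaler_sumr; congr (_ *: _).
  rewrite [in RHS](basis (p j)) linear_sum; apply: eq_bigr => i _.
  by rewrite linearZ.
rewrite -linear_sum; congr (lam _); apply: homP => x.
rewrite hom_sumE [in RHS](basis x) linear_sum; apply: eq_bigr => i _.
by rewrite linearZ.
Qed.

(** For f = [phi j] this is the coordinate of w along [p j]; on xi (x) x it is xi acted on from the
    right by phi_j x. *)
Definition nak_coef_fun (f : homreg P) (w : nakayama P)
  (r : kspace R^c (R^c)^o) : k^o := nak_pair ((r : R^c) *: f) w.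

Fact nak_coef_linear f w : linear (nak_coef_fun f w).
Proof.
move=> c r s; rewrite /nak_coef_fun -nak_pairZ -nak_pairZ -nak_pairZ.
rewrite -[X in _ = X + _]nak_pair_alg_unit -[RHS]nak_pairD.
rewrite -[LHS]/(nak_pair f (((r : R) * alg_unit R c + (s : R)) *: w)).
by rewrite scalerDl -alg_unitC scalerA.
Qed.

Definition nak_coef f w : dualreg R := linear_of (@nak_coef_linear f w).

(** Expanding x in the dual basis and moving its coefficients across the tensor sign gives xi (x) x
    = \sum_j xi (phi_j x) (x) p_j. *)
Lemma nak_expand w : \sum_(j < n) (tens (nak_coef (phi j) w) (p j) : nakayama P) = w.
Proof.
elim/nakayama_ind: w => [|xi x w IHw].
  rewrite big1 // => j _; rewrite (_ : nak_coef _ _ = 0); first exact/tclassP/teq_0l.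
  by apply: homP => r; exact: (nak_pair0 ((r : R^c) *: phi j)).
rewrite -[in RHS]IHw [in RHS](basis x) tens_sumr -big_split; apply: eq_bigr => j _.
rewrite /= -tens_balanced -tensDl; congr (tens _ _ : nakayama P).
apply: homP => r; rewrite /= /nak_coef_fun nak_pairD nak_pair_tens //.
Qed.

(** After [nak_expand], the coefficients at each [p j] are compared; they agree because \sum_i phi_i
    (phi_j (p_i) r) = phi_j r in the right module Hom(P, R). *)
Lemma cotraceK g : cotrace (nak_trace g) = g.
Proof.
apply: homP => t; rewrite -[RHS]nak_expand /= /cotrace_fun.
apply: eq_bigr => j _; congr (tens _ _ : nakayama P); apply: homP => r.
rewrite /= /cotrace_coef_fun /nak_coef_fun /= /nak_trace_fun /=.
transitivity (\sum_(i < n)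
    nak_pair ((phi j $ (p i) * (r : R) : R^c) *: phi i) ((g : modhom _ _) t)).
  apply: eq_bigr => i _; rewrite /rank1_fun scalerA linearZ.
  by rewrite -[RHS]nak_pairZ.
rewrite -nak_pair_suml; apply: (congr1 (@nak_pair k R P ^~ _)).
apply: homP => x.
rewrite hom_sumE [in RHS](basis x) linear_sum.
apply: eq_bigr => i _; rewrite linearZ /=.
by [].
Qed.
End NakayamaTrace.

(** * The decomposition of E T into T and Hom(P, T) *)

Section OpeRow.
Variables (k : fieldType) (R : centralAlgType k) (P T : lmodType R).

Fact ope_row_mk_subproof b x : (b, x, 0) \in @ope_row_pred k R P.
Proof.
rewrite inE; apply/eqP; congr (_, _, _); rewrite /= ?mul1r ?mul0r //.
by rewrite scale1r scaler0 addr0.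
Qed.
Definition ope_row_mk b x : ope_row P := OpeRow (ope_row_mk_subproof b x).

Lemma ope_rowE (u : ope_row P) : u = ope_row_mk (val u).1.1 (val u).1.2.
Proof.
apply: val_inj; case: u => [[[b x] c] uP] /=; congr (_, _, _).
by have /eqP := uP; rewrite /= => /(congr1 snd) /= <-; rewrite mul0r.
Qed.

(** The last entry of [u] is 0, so the P-entry of [v] contributes nothing to the product. *)
Lemma ope_row_rmulE (u v : ope_row P) :
  ope_row_rmul v (val u) = (val v).1.1 *: u.
Proof.
apply: val_inj; rewrite (ope_rowE u) (ope_rowE v) /=.
by congr (_, _, _); rewrite /= ?rmorph0 ?scale0r ?mul0r ?scaler0.
Qed.

Implicit Types (f : hom_row P T) (h : homE P T) (t : T) (a : one_point P).

Lemma hom_row_scaleE a f u :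
  ((a *: f : hom_row P T) : modhom _ _) u = (f : modhom _ _) (ope_row_rmul u a).
Proof. by []. Qed.

(** Restriction to P inside U = R + P; it represents e f under the identification of e (E T) with
    Hom(P, T). *)
Definition top_part_fun f (x : P) : T := (f : modhom _ _) (ope_row_mk 0 x).

Fact top_part_linear f : linear (top_part_fun f).
Proof.
move=> r x y; rewrite /top_part_fun -linearP; congr (hom_fun _ _).
by apply: val_inj; congr (_, _, _); rewrite /= ?mulr0 ?scaler0 ?addr0.
Qed.

Definition top_part f : homE P T := linear_of (@top_part_linear f).

(** In U, (0, x) a = (0, a.2 x). Thus a k-linear form on Hom(P, T) composed with [top_part] is
    A-linear into the vertex module. *)
Lemma top_partZ a f :
  top_part (a *: f) = (alg_unit (endo P) a.2 : endo P) *: top_part f.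
Proof.
apply: homP => x; rewrite /= /top_part_fun hom_row_scaleE.
congr (hom_fun _ _); apply: val_inj.
by congr (_, _, _); rewrite /= ?mul0r // scale0r add0r.
Qed.

Lemma top_partD f g : top_part (f + g) = top_part f + top_part g.
Proof. exact: homP. Qed.

(** The inclusion of T, as the part of E T fixed by the identity of R: the map with value t at that
    identity and 0 on P. *)
Definition of_elt_fun t (u : ope_row P) : T := (val u).1.1 *: t.

Fact of_elt_linear t : linear (of_elt_fun t).
Proof.
move=> r u v; rewrite /of_elt_fun scalerA -scalerDl; congr (_ *: _).
Qed.

Definition of_elt t : hom_row P T := linear_of (@of_elt_linear t).

(** Both sides send v to f (v u) = v.1.1 f(u). So values of f can be read off from the A-action,
    which makes E full. *)
Lemma scale_of_elt f (u : ope_row P) :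
  val u *: f = of_elt ((f : modhom _ _) u).
Proof.
by apply: homP => v; rewrite hom_row_scaleE ope_row_rmulE linearZ.
Qed.

Lemma of_eltD r t u : of_elt (r *: t + u) = ope_corner P r *: of_elt t + of_elt u.
Proof.
apply: homP => v; rewrite /= /of_elt_fun scalerDr scalerA; congr (_ + _).
Qed.

Definition of_hom_fun h (u : ope_row P) : T := (h : modhom _ _) (val u).1.2.

Fact of_hom_linear h : linear (of_hom_fun h).
Proof.
move=> r u v; rewrite /of_hom_fun -linearP; congr (hom_fun _ _).
by rewrite /= scaler0 addr0.
Qed.

Definition of_hom h : hom_row P T := linear_of (@of_hom_linear h).

Lemma of_homZ c h :
  of_hom ((alg_unit (endo P) c : endo P) *: h) = ope_scal P c *: of_hom h.
Proof.
apply: homP => u; rewrite hom_row_scaleE /= /of_hom_fun /=.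
by congr (hom_fun _ _); rewrite scaler0 add0r.
Qed.

Lemma of_homD h g : of_hom (h + g) = of_hom h + of_hom g.
Proof. exact: homP. Qed.

Lemma of_homK h : top_part (of_hom h) = h.
Proof. exact: homP. Qed.

(** Additivity of f along U = R + P. *)
Lemma hom_row_decomp f :
  f = of_elt ((f : modhom _ _) (ope_row_mk 1 0)) + of_hom (top_part f).
Proof.
apply: homP => u.
rewrite -[RHS]/(of_elt_fun _ u + of_hom_fun _ u) /of_elt_fun /of_hom_fun /=.
rewrite /top_part_fun -linearP; congr (hom_fun _ _); rewrite [LHS]ope_rowE.
by apply: val_inj; congr (_, _, _);
  rewrite /= ?mulr1 ?addr0 ?mulr0 ?scaler0 ?add0r.
Qed.
End OpeRow.

(** * The isomorphism between End(E T + S) and the one-point extension *)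

Section EndExtension.
Variables (k : fieldType) (R : centralAlgType k) (P T : lmodType R).
Variables (n : nat) (p : 'I_n -> P) (phi : 'I_n -> homreg P).
Hypothesis basis :
  forall x, x = \sum_(i < n) ((phi i : modhom P R^o) x : R) *: p i.
Variables (S : lmodType (one_point P)) (io : {linear vertex P -> S}).
Variable chi : {linear S -> vertex P}.
Hypotheses (ioK : cancel io chi) (chiK : cancel chi io).
Local Notation A := (one_point P).
Local Notation ET := (hom_row P T).
Local Notation M := (ET * S)%type.
Local Notation E := (one_point (homE T (nakayama P))).
Local Notation tr := (nak_trace (T := T) p phi).

Lemma chiZ (a : A) s : (chi (a *: s) : k) = a.2 * (chi s : k).
Proof. exact: (linearZ_LR chi). Qed.

(** The triple (e, g, c) as a triangular matrix: e acts on E T by postcomposition, g maps E T to S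
    by its trace form, c scales S, and nothing goes from S to E T. *)
Definition ext_endo_fun (a : E) (m : M) : M :=
  (hom_comp (a.1.1 : modhom T T) (m.1 : modhom _ _) : ET,
   io (tr a.1.2 (top_part m.1) + a.2 * (chi m.2 : k) : k)).

Fact ext_endo_linear a : linear (ext_endo_fun a).
Proof.
move=> b m m'; congr (_, _).
  by apply: homP => u /=; rewrite linearD.
have trE : tr a.1.2 (top_part (b *: m.1 + m'.1)) =
    b.2 * (tr a.1.2 (top_part m.1) : k) + tr a.1.2 (top_part m'.1) :> k.
  by rewrite top_partD top_partZ; exact: (linearP (tr a.1.2) b.2).
have chiE : chi (b *: m.2 + m'.2) = b.2 * (chi m.2 : k) + (chi m'.2 : k) :> k.
  exact: (linearP chi).
rewrite -[RHS](linearP io); apply: (congr1 io).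
rewrite -[LHS]/(tr a.1.2 (top_part (b *: m.1 + m'.1)) +
  a.2 * (chi (b *: m.2 + m'.2) : k) : k) trE chiE.
rewrite -[RHS]/(b.2 * (tr a.1.2 (top_part m.1) + a.2 * (chi m.2 : k)) +
   (tr a.1.2 (top_part m'.1) + a.2 * (chi m'.2 : k)) : k).
by rewrite !mulrDr addrACA mulrCA.
Qed.

Definition ext_endo a : endo M := linear_of (@ext_endo_linear a).

Lemma nak_traceB g g' h : tr (g - g') h = tr g h - tr g' h.
Proof.
rewrite /= /nak_trace_fun -sumrB; apply: eq_bigr => i _.
exact: (nak_pairB (phi i) ((g : modhom _ _) ((h : modhom P T) (p i)))).
Qed.

Fact ext_endo_zmod_morphism : zmod_morphism ext_endo.
Proof.
move=> a b; apply: homP => m; congr (_, _); first exact: homP.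
rewrite -[RHS](linearB io); apply: (congr1 io).
rewrite -[LHS]/(tr (a.1.2 - b.1.2) (top_part m.1) +
  (a.2 - b.2) * (chi m.2 : k) : k) nak_traceB mulrBl.
rewrite -[RHS]/((tr a.1.2 (top_part m.1) + a.2 * (chi m.2 : k)) -
   (tr b.1.2 (top_part m.1) + b.2 * (chi m.2 : k)) : k).
by rewrite opprD addrACA.
Qed.

Lemma nak_trace0 h : tr 0 h = 0.
Proof. by rewrite -(subrr 0) nak_traceB subrr. Qed.

(** End(T) acts on g by precomposition, which the trace form sees as composing h with e. *)
Lemma nak_traceM (e : endo T) c g g' h :
  tr (e *: g + alg_unit (endo T) c *: g') h =
  (tr g (hom_comp (e : modhom T T) (h : modhom P T)) : k) + c * (tr g' h : k).
Proof.
rewrite mulr_sumr -big_split; apply: eq_bigr => i _ /=.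
rewrite -nak_pair_alg_unit -(linearZ_LR (g' : modhom _ _)).
exact: (nak_pairD (phi i)
  ((g : modhom _ _) ((e : modhom T T) ((h : modhom P T) (p i))))).
Qed.

(** Products are read from left to right: the corner of [b] is applied after the diagonal entry of
    [a], and the scalar of [b] multiplies the corner of [a], exactly as in the matrix product. *)
Fact ext_endo_monoid_morphism : monoid_morphism ext_endo.
Proof.
split=> [|a b]; apply: homP => m.
  case: m => f s; congr (_, _); first exact: homP.
  rewrite -[RHS]chiK; apply: (congr1 io).
  rewrite -[LHS]/(tr 0 (top_part f) + 1 * (chi s : k) : k).
  by rewrite mul1r nak_trace0 add0r.
congr (_, _); first exact: homP.
apply: (congr1 io).
rewrite -[LHS]/(tr (a.1.1 *: b.1.2 + alg_unit (endo T) b.2 *: a.1.2)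
  (top_part m.1) + (a.2 * b.2) * (chi m.2 : k) : k) nak_traceM.
rewrite -[RHS]/(tr b.1.2
    (hom_comp (a.1.1 : modhom T T) (top_part m.1 : modhom P T)) +
  b.2 * (chi (io (tr a.1.2 (top_part m.1) + a.2 * (chi m.2 : k) : k)) : k) : k).
by rewrite ioK mulrDr addrA mulrA [b.2 * a.2]mulrC.
Qed.

Fact ext_endo_unit c : ext_endo (alg_unit E c) = alg_unit (endo M) c.
Proof.
apply: homP => -[f s]; congr (_, _).
  apply: homP => u; rewrite -[LHS]/(alg_unit R c *: (f : modhom _ _) u).
  rewrite -[RHS]/((f : modhom _ _) (ope_row_rmul u (alg_unit A c))).
  rewrite -linearZ_LR; congr (hom_fun _ _); apply: val_inj.
  rewrite [u]ope_rowE; congr (_, _, _); rewrite /= ?mul0r ?alg_unitC //.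
  by rewrite !scaler0 addr0 add0r.
rewrite -[RHS]chiK; apply: (congr1 io).
rewrite [RHS]chiZ -[LHS]/(tr 0 (top_part f) + c * (chi s : k) : k).
by rewrite nak_trace0 add0r.
Qed.

HB.instance Definition _ := GRing.isZmodMorphism.Build E (endo M) ext_endo
  ext_endo_zmod_morphism.
HB.instance Definition _ := GRing.isMonoidMorphism.Build E (endo M) ext_endo
  ext_endo_monoid_morphism.

Implicit Types w : endo M.
Local Notation ap w m := ((w : modhom M M) m : M).

Definition unit_row : ope_row P := ope_row_mk 1 0.

(** The entry of w in End(T), seen on the copy of T in E T and evaluated at the identity of R. *)
Definition diag_fun w (t : T) : T :=
  ((ap w (of_elt P t, 0)).1 : modhom _ _) unit_row.

Fact diag_linear w : linear (diag_fun w).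
Proof.
move=> r t u; rewrite /diag_fun.
have -> : ((of_elt P (r *: t + u), 0) : M) =
    ope_corner P r *: ((of_elt P t, 0) : M) + (of_elt P u, 0).
  by rewrite of_eltD; congr (_, _); rewrite /= scaler0 addr0.
rewrite linearP -[LHS]/(((ap w (of_elt P t, 0)).1 : modhom _ _)
  (ope_row_rmul unit_row (ope_corner P r)) + diag_fun w u).
rewrite (_ : ope_row_rmul _ _ = r *: unit_row) ?linearZ //.
apply: val_inj; congr (_, _, _); rewrite /= ?mulr0 ?mul1r ?mulr1 //.
by rewrite !scaler0.
Qed.
Definition diag w : endo T := linear_of (@diag_linear w).

(** The component E T -> S is determined by its restriction to Hom(P, T), as the identity of R kills
    S. *)
Definition corner_fun w (h : kspace (endo P) (homE P T)) : k^o :=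
  chi (ap w (of_hom (h : homE P T), 0)).2.

Fact corner_linear w : linear (corner_fun w).
Proof.
move=> c h h'; rewrite /corner_fun.
have -> : ((of_hom (c *: h + h' : kspace (endo P) (homE P T)), 0) : M) =
    ope_scal P c *: ((of_hom (h : homE P T), 0) : M) + (of_hom (h' : homE P T), 0).
  by rewrite of_homD of_homZ; congr (_, _); rewrite /= scaler0 addr0.
rewrite linearP; exact: (linearP chi).
Qed.
Definition corner w := linear_of (@corner_linear w).

Definition scalar w : k := chi (ap w (0, io (1 : k))).2.

Definition endo_ext w : E := (diag w, cotrace p phi (corner w), scalar w).

Lemma ext_endoK : cancel ext_endo endo_ext.
Proof.
move=> [[e g] c]; congr (_, _, _).
- apply: homP => t; rewrite -[LHS]/((e : modhom T T) (1 *: t)).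
  by rewrite scale1r.
- rewrite -[RHS](cotraceK basis); apply: (congr1 (cotrace p phi)).
  apply: homP => h.
  rewrite -[LHS]/(chi (io (tr g (top_part (of_hom h)) + c * (chi 0 : k) : k))).
  by rewrite ioK of_homK linear0 mulr0 addr0.
- rewrite -[LHS]/(chi (io (tr g (top_part 0) + c * (chi (io (1 : k)) : k) : k)) : k).
  by rewrite !ioK mulr1 (_ : top_part 0 = 0) ?linear0 ?add0r //; exact: homP.
Qed.

Lemma vertex_scaleE (a : A) s : a *: s = io (a.2 * (chi s : k) : k).
Proof. by rewrite -chiZ chiK. Qed.

(** This is Hom_A(S, E T) = 0. As s = e s, the image of s at u is its value at u e, hence the value
    at the identity of R of the image of (u e) s; and u e has last entry 0, so it kills S. *)
Lemma row_first_zero w s : (ap w (0, s)).1 = 0.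
Proof.
have eE : ((0, s) : M) = ope_scal P 1 *: ((0, s) : M).
  congr (_, _) => /=; first by rewrite scaler0.
  by rewrite vertex_scaleE mul1r chiK.
apply: homP => u; rewrite eE linearZ /= hom_row_scaleE.
set v := ope_row_rmul u _.
have <- : ope_row_rmul unit_row (val v) = v by rewrite ope_row_rmulE scale1r.
rewrite -hom_row_scaleE -[X in hom_fun X]/((val v *: ap w (0, s)).1) -linearZ.
have -> : val v *: ((0, s) : M) = (0, 0); last by rewrite linear0.
congr (_, _) => /=; first by rewrite scaler0.
by rewrite vertex_scaleE /= (ope_rowE u) /= mul0r mul0r linear0.
Qed.

Lemma endo_extK : cancel endo_ext ext_endo.
Proof.
move=> w; apply: homP => -[f s].
rewrite [RHS]surjective_pairing; congr (_, _).
  have fsE : ((f, s) : M) = ((f, 0) : M) + (0, s).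
    by congr (_, _); rewrite /= ?addr0 ?add0r.
  rewrite [in RHS]fsE (linearD (w : modhom M M)) -[RHS]/((ap w (f, 0)).1 + (ap w (0, s)).1).
  rewrite row_first_zero addr0; apply: homP => u.
  (* The element of E T attached to f(u) is u f, so A-linearity of [w] recovers its value on f. *)
  rewrite -[LHS]/(diag_fun w ((f : modhom _ _) u)) /diag_fun -scale_of_elt.
  have -> : ((val u *: f, 0) : M) = val u *: ((f, 0) : M).
    by congr (_, _); rewrite /= scaler0.
  by rewrite linearZ /= hom_row_scaleE ope_row_rmulE scale1r.
rewrite -[RHS]chiK; apply: (congr1 io).
rewrite -[LHS]/(tr (cotrace p phi (corner w)) (top_part f) +
  scalar w * (chi s : k) : k) (nak_traceK basis).
set t := (f : modhom _ _) (ope_row_mk 1 0).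
(* The pair splits into its parts in T, Hom(P, T) and S; the first is fixed by the identity of R and
   has no image in S. *)
have -> : ((f, s) : M) = ope_corner P 1 *: ((of_elt P t, 0) : M) +
    (((of_hom (top_part f), 0) : M) + ope_scal P (chi s) *: ((0, io (1 : k)) : M)).
  congr (_, _) => /=.
    rewrite scaler0 addr0 [LHS]hom_row_decomp -/t; congr (_ + _).
    by apply: homP => u; rewrite hom_row_scaleE /= /of_elt_fun /= mulr1.
  by rewrite scaler0 !add0r vertex_scaleE ioK mulr1 chiK.
rewrite !(linearD (w : modhom M M)) !(linearZ_LR (w : modhom M M)).
rewrite -[RHS]/(chi (ope_corner P 1 *: (ap w (of_elt P t, 0)).2 +
  ((ap w (of_hom (top_part f), 0)).2 +
   ope_scal P (chi s) *: (ap w (0, io (1 : k))).2))).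
rewrite !(linearD chi) !chiZ mul0r add0r.
by congr (_ + _); exact: mulrC.
Qed.

Lemma end_one_point_iso : alg_iso (endo M) E.
Proof.
have bij : bijective endo_ext by exists ext_endo; [exact: endo_extK|exact: ext_endoK].
have zm : zmod_morphism endo_ext by exact: (can2_zmod_morphism ext_endoK endo_extK).
have mm : monoid_morphism endo_ext by exact: (can2_monoid_morphism ext_endoK endo_extK).
pose F : {rmorphism endo M -> E} := HB.pack endo_ext
  (GRing.isZmodMorphism.Build (endo M) E endo_ext zm)
  (GRing.isMonoidMorphism.Build (endo M) E endo_ext mm).
exists F; split=> [//|c]; rewrite -ext_endo_unit; exact: ext_endoK.
Qed.

End EndExtension.

(** * Choice of a dual basis, and conclusion *)

Lemma end_ext_alg_iso (k : fieldType) (R : centralAlgType k) (P T : lmodType R)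
    (S : lmodType (one_point P)) :
  fin_gen P -> projective P -> iso (vertex P) S ->
  alg_iso (endo (hom_row P T * S)%type) (one_point (homE T (nakayama P))).
Proof.
move=> Pfg Pproj [io [chi ioK chiK]].
have [n [p [phi basis]]] := projective_dual_basis Pfg Pproj.
have chi_lin : linear chi := can2_linear ioK chiK.
exact: (@end_one_point_iso k R P T n p phi basis S io (linear_of chi_lin)).
Qed.

Theorem theorem2p14 (k : closedFieldType) (B : falgType k)
    (hbasic : basic_ring B) (hconn : connected_alg B)
    (P0 : lmodType B) (hP0 : fin_gen P0) (hP0proj : projective P0)
    (Pt S : lmodType (one_point P0))
    (hPt : fin_gen Pt) (hPtproj : projective Pt) (hPtind : indecomposable Pt)
    (hPtB : ~ exists Q : lmodType B,
        projective Q /\ iso Pt (restr (ope_proj (X := P0)) Q))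
    (hS : is_top Pt S)
    (T : lmodType B) (hT : tau_tilting T) :
  alg_iso (endo (hom_row P0 T * S)%type)
          (one_point (homE T (nakayama P0))).
Proof.
apply: end_ext_alg_iso => //.
exact: (top_vertex hPt hPtproj hPtind hPtB hS).
Qed.
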